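(* There is a deterministic online algorithm which, for any sequence of points $x_1,\ldots,x_n$ of a metric space $(X,d_X)$ arriving in an online fashion, produces an online embedding into Euclidean space $\ell_2$ with distortion $O(\mathrm{ddim})\cdot\min\{\sqrt{\log\Phi},\sqrt{n}\}$, where $\Phi$ is the aspect ratio and $\mathrm{ddim}$ is the doubling dimension of $\{x_1,\ldots,x_n\}$. No prior knowledge (of $n$, $\Phi$ or $\mathrm{ddim}$) is required.
   Context: An online embedding of a sequence $x_1,\dots,x_k$ of points of a metric space $(X,d_X)$ into a metric space $(Y,d_Y)$ is a sequence of maps $f_1,\dots,f_k$, where $f_i:\{x_1,\dots,x_i\}\to Y$ and $f_{i+1}$ extends $f_i$; in an online embedding algorithm $f_i$ may depend only on $x_1,\dots,x_i$ (the distances among them). Its expansion is $\alpha=\max_{i,j}\frac{d_Y(f_k(x_i),f_k(x_j))}{d_X(x_i,x_j)}$, its contraction is $\beta=\max_{i,j}\frac{d_X(x_i,x_j)}{d_Y(f_k(x_i),f_k(x_j))}$, and its distortion is $\alpha\beta$. The aspect ratio of a finite metric is $\Phi=\max d_X(x,y)/\min_{x\neq y} d_X(x,y)$. A metric space has doubling dimension $\mathrm{ddim}$ if every ball of radius $2r$ can be covered by $2^{\mathrm{ddim}}$ balls of radius $r$ (for every $r>0$).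
   Formalization: log Φ is read as max(1, log₂ Φ): as literally stated the bound fails for Φ = 1 (for example two distinct points), where log Φ = 0 although every embedding has distortion at least 1; nothing changes for Φ ≥ 2. *)

(* Defs.v *)
From HB Require Import structures.
From mathcomp Require Import all_boot all_order all_algebra finmap.
From mathcomp Require Import all_classical all_reals all_analysis.

Set Implicit Arguments.
Unset Strict Implicit.
Unset Printing Implicit Defensive.

Import Order.TTheory GRing.Theory Num.Theory.
Local Open Scope classical_set_scope.
Local Open Scope ring_scope.

(* The only null set of the counting measure is set0, so no quotient is needed:
   by Lnorm_counting, the elements are the square-summable real sequences. *)
Definition ell2 (R : realType) : Type :=
  LfunType (@counting nat R) (lee1n 2).

Section Ell2Metric.
Context {R : realType}.

HB.instance Definition _ := GRing.Lmodule.on (ell2 R).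

Definition ell2_dist (f g : ell2 R) : R :=
  fine ('N[@counting nat R]_2%:E [EFin \o (f - g)%R])%E.

Lemma ell2_distxx f : ell2_dist f f = 0.
Proof.
rewrite /ell2_dist subrr (_ : EFin \o _ = cst 0%E) ?Lnorm0 ?pnatr_eq0//.
Qed.

Lemma ell2_dist_eq0 f g : ell2_dist f g = 0 -> f = g.
Proof.
move=> /fine_Lnormr_eq0 /= [A [mA A0 sA]].
have {A0}Ae : A = set0.
  move: A0; rewrite /counting; case: ifPn => [/asboolP fA|//].
  by move=> [/eqP]; rewrite pnatr_eq0 cardfs_eq0 => /eqP/(fset_set_set0 fA).
apply/LfuneqP => k; apply/eqP; rewrite -subr_eq0; apply/eqP.
apply: contrapT => fgk; have : A k by apply: sA => /(_ I).
by rewrite Ae.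
Qed.

Lemma ell2_dist_sym f g : ell2_dist f g = ell2_dist g f.
Proof.
rewrite /ell2_dist -(LnormrN (f - g)).
by congr (fine _); apply: eq_Lnorm => k /=; rewrite opprB.
Qed.

Lemma ell2_dist_triangle g f h :
  ell2_dist f h <= ell2_dist f g + ell2_dist g h.
Proof.
have -> : ell2_dist f h = fine ('N[@counting nat R]_2%:E
    [EFin \o ((f - g) + (g - h))%R])%E.
  by rewrite addrA subrK.
exact: ler_LnormD.
Qed.

HB.instance Definition _ := isMetric.Build R (ell2 R)
  ell2_distxx ell2_dist_eq0 ell2_dist_sym ell2_dist_triangle.

End Ell2Metric.

Section OnlineEmbedding.
Context {R : realType}.
Implicit Types X Y : metricType R.

(* The maps f_i : {x_1, ..., x_i} -> Y are given on indices; the points may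
   repeat, so f_i has to be compatible with equality of points.  The converse
   implication (injectivity) makes the contraction below meaningful. *)
Definition prefix_seq X n (x : 'I_n -> X) i (lein : (i <= n)%N) : 'I_i -> X :=
  x \o widen_ord lein.

Definition online_embedding X Y n (x : 'I_n -> X)
    (f : forall i, (i <= n)%N -> 'I_i -> Y) : Prop :=
  (forall i (lein : (i <= n)%N) (a b : 'I_i),
     f i lein a = f i lein b <->
     prefix_seq x lein a = prefix_seq x lein b) /\
  (forall i (lein : (i <= n)%N) (ltin : (i < n)%N) (a : 'I_i),
     f i.+1 ltin (widen_ord (leqnSn i) a) = f i lein a).

(* Given the distance matrix of the first i points, the algorithm returns the
   images of these i points. *)
Definition online_algorithm Y : Type := forall i : nat, 'M[R]_i -> 'I_i -> Y.

Definition dist_mx X n (x : 'I_n -> X) : 'M[R]_n :=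
  \matrix_(i, j) mdist (x i) (x j).

Definition run X Y (A : online_algorithm Y) n (x : 'I_n -> X)
    i (lein : (i <= n)%N) : 'I_i -> Y :=
  A i (dist_mx (prefix_seq x lein)).

Definition expansion X Y n (x : 'I_n -> X) (f : 'I_n -> Y) : R :=
  \big[Num.max/0]_(p : 'I_n * 'I_n | x p.1 != x p.2)
    (mdist (f p.1) (f p.2) / mdist (x p.1) (x p.2)).

Definition contraction X Y n (x : 'I_n -> X) (f : 'I_n -> Y) : R :=
  \big[Num.max/0]_(p : 'I_n * 'I_n | x p.1 != x p.2)
    (mdist (x p.1) (x p.2) / mdist (f p.1) (f p.2)).

Definition distortion X Y n (x : 'I_n -> X) (f : 'I_n -> Y) : R :=
  expansion x f * contraction x f.

Definition diam X n (x : 'I_n -> X) : R :=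
  \big[Num.max/0]_(p : 'I_n * 'I_n) mdist (x p.1) (x p.2).

(* The default value diam x does not affect the minimum, unless there are
   fewer than two distinct points. *)
Definition min_dist X n (x : 'I_n -> X) : R :=
  \big[Num.min/diam x]_(p : 'I_n * 'I_n | x p.1 != x p.2)
    mdist (x p.1) (x p.2).

Definition aspect_ratio X n (x : 'I_n -> X) : R := diam x / min_dist x.

(* Balls and their centers are those of the subspace S. *)
Definition has_ddim X (S : set X) (D : R) : Prop :=
  forall (c : X) (r : R), S c -> 0 < r ->
  exists s : seq X, [/\ (size s)%:R <= 2 `^ D,
    [set` s] `<=` S &
    S `&` ball c (2 * r) `<=` \bigcup_(y in [set` s]) ball y r].

(* Every embedding of two or more distinct points has distortion at least 1,
   while log Phi tends to 0 as Phi tends to 1: inside the O-bound, log Phi is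
   truncated from below at 1. This changes nothing when Phi >= 2. *)
Definition log_bound (Phi : R) : R := Num.max 1 (ln Phi / ln 2).

End OnlineEmbedding.

(* Main.v *)
(** For each integer z, the points arriving online define a greedy net at
    scale 2^z.  A net point l is surrounded by a tent function h_l, equal to 1 up to
    distance 2^z and to 0 from distance 2 * 2^z on.  With s_l = 2 h_l / (1 + h_l^2) and
    c_l = (1 - h_l^2) / (1 + h_l^2), the hyperspherical coordinates
    s_l * \prod_(m < l) c_m form a unit vector, which depends only on the net
    points that arrived so far, and which has disjoint supports for points at
    distance at least 4 * 2^z.  The embedding is the orthogonal sum over all z
    of these vectors multiplied by 2^z; this bounds the contraction.

    The tent decays exponentially at rate ln (r + 3), down to an additive
    slack 1 / (r + 2), where r is the number of earlier net points near l.  The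
    relative part of the variation of the tents is absorbed by the spherical
    weights, the slacks are square-summable over the net points near a given
    pair, and r <= 2^(4 ddim), so that each scale is O(ddim)-Lipschitz without
    the algorithm knowing ddim.  A pair at distance d gets a geometrically
    decaying contribution from the scales 2^z < d; a scale 2^z >= d matters only
    if some point l lies at distance between 2^z and 2 * 2^z from the pair, so at
    most O(min (log Phi, n)) of these scales matter. *)
Require Import Defs.
From mathcomp Require Import all_boot all_order all_algebra.
From mathcomp Require Import all_classical all_reals all_analysis.
From mathcomp Require Import lra ring zify.
Set Implicit Arguments.
Unset Strict Implicit.
Unset Printing Implicit Defensive.
Import Order.TTheory GRing.Theory Num.Theory.
Local Open Scope classical_set_scope.
Local Open Scope ring_scope.

(** * Distances in [ell2] *)

Lemma sqr_poweR2 (R : realType) (r : R) : (`|r%:E| `^ 2)%E = (r ^+ 2)%:E.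
Proof.
by rewrite abse_EFin poweR_EFin powR_mulrn// real_normK// num_real.
Qed.

(** The terms are nonnegative, so the series is the supremum of its partial sums; every later
    estimate can then be made on finite real sums. *)
Lemma nneseries_sqr_le (R : realType) (u : nat -> R) (B : R) :
  (\sum_(0 <= k <oo) `|(u k)%:E| `^ 2 <= B%:E)%E <->
  (forall N, \sum_(k < N) (u k) ^+ 2 <= B).
Proof.
under eq_eseriesr do rewrite sqr_poweR2.
split=> [uB N|uB].
  rewrite -lee_fin -sumEFin -(big_mkord xpredT (fun k => (u k ^+ 2)%:E)).
  apply: le_trans uB; apply: nneseries_lim_ge => i _ _.
  by rewrite lee_fin sqr_ge0.
apply: lime_le; first by apply: is_cvg_nneseries => i _ _; rewrite lee_fin sqr_ge0.
by apply: nearW => N /=; rewrite sumEFin lee_fin big_mkord.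
Qed.

Lemma Lfun2_bounded (R : realType) (f : nat -> R) (B : R) :
  (forall N, \sum_(k < N) (f k) ^+ 2 <= B) ->
  f \in @Lfun _ nat R (@counting nat R) 2%:E.
Proof.
move=> /nneseries_sqr_le fB; apply/andP; split; rewrite inE /=.
  by move=> _ Y _; exact: I.
rewrite /finite_norm Lnorm_counting ?ltr0n// poweR_lty//.
exact: le_lt_trans fB (ltry _).
Qed.

(** Taking for [B] the distance itself turns this upper-bound criterion into a lower bound on the
    distance by any partial sum. *)
Lemma ell2_distP (R : realType) (f g : ell2 R) (B : R) : 0 <= B ->
  (ell2_dist f g <= B) <->
  (forall N, \sum_(k < N) (f k - g k) ^+ 2 <= B ^+ 2).
Proof.
move=> B0; rewrite -(nneseries_sqr_le (fun k => f k - g k)) /ell2_dist.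
have ffin : ('N[@counting nat R]_2%:E [EFin \o (f - g)%R] < +oo)%E.
  have := LfunP (f - g : LfunType _ _). move=> /andP[_]. rewrite inE. exact.
have E : ('N[@counting nat R]_2%:E [EFin \o (f - g)%R] `^ 2 =
    \sum_(0 <= k <oo) `|(f k - g k)%:E| `^ 2)%E.
  rewrite Lnorm_counting ?ltr0n// -poweRrM mulVf ?pnatr_eq0// poweRe1//.
  by apply: nneseries_ge0 => k _ _; exact: poweR_ge0.
rewrite -E; set a := 'N[_]_2%:E[_]%E in ffin *.
have a0 : (0 <= a)%E by exact: Lnorm_ge0.
have afin : a \is a fin_num by rewrite ge0_fin_numE.
rewrite -{2}(fineK afin) poweR_EFin lee_fin powR_mulrn ?fine_ge0//.
by rewrite ler_sqr// nnegrE fine_ge0.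
Qed.

(** * Hyperspherical coordinates *)

Section Spherical.
Variables (R : realType).
Implicit Types (h e : nat -> R) (n : nat) (t : R).

(** The rational parametrization of the circle: with t the tangent of half the angle, these are its
    sine and cosine. For t in [0, 1] the angle runs over the first quadrant, and t = 1 makes the
    cosine vanish. *)
Definition sph_sin (t : R) := 2 * t / (1 + t ^+ 2).
Definition sph_cos (t : R) := (1 - t ^+ 2) / (1 + t ^+ 2).
Definition sph_rest h n := \prod_(m < n) sph_cos (h m).
Definition sph_coord h n := sph_sin (h n) * sph_rest h n.

Lemma sph_den_gt0 (t : R) : 0 < 1 + t ^+ 2.
Proof. by have := sqr_ge0 t; lra. Qed.

Lemma sph_pythagoras t : sph_sin t ^+ 2 + sph_cos t ^+ 2 = 1.
Proof.
by rewrite /sph_sin /sph_cos; field; exact: lt0r_neq0 (sph_den_gt0 t).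
Qed.

Lemma sph_cos_ge0 t : 0 <= t <= 1 -> 0 <= sph_cos t.
Proof.
move=> /andP[t0 t1]; rewrite /sph_cos divr_ge0 ?(ltW (sph_den_gt0 t))//.
by nra.
Qed.

Lemma sph_sin_ge0 t : 0 <= t -> 0 <= sph_sin t.
Proof.
by move=> t0; rewrite /sph_sin divr_ge0 ?(ltW (sph_den_gt0 t))// mulr_ge0.
Qed.

Lemma sph_cos_le1 t : 0 <= t <= 1 -> sph_cos t <= 1 - t ^+ 2.
Proof.
move=> /andP[t0 t1]; rewrite /sph_cos ler_pdivrMr ?sph_den_gt0//.
have : t ^+ 2 <= 1 by rewrite expr_le1.
by have := sqr_ge0 t; nra.
Qed.

(** The exact chord formula of stereographic projection; its denominator is at least 1. *)
Lemma sph_chord t (t' : R) :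
  (sph_sin t - sph_sin t') ^+ 2 + (sph_cos t - sph_cos t') ^+ 2
    <= 4 * (t - t') ^+ 2.
Proof.
have d0 := lt0r_neq0 (sph_den_gt0 t); have d1 := lt0r_neq0 (sph_den_gt0 t').
have -> : (sph_sin t - sph_sin t') ^+ 2 + (sph_cos t - sph_cos t') ^+ 2 =
  4 * (t - t') ^+ 2 / ((1 + t ^+ 2) * (1 + t' ^+ 2)).
  by rewrite /sph_sin /sph_cos; field; apply/andP.
rewrite ler_pdivrMr ?mulr_gt0 ?sph_den_gt0// ler_peMr//.
  by rewrite mulr_ge0// sqr_ge0.
by have := sqr_ge0 t; have := sqr_ge0 t'; nra.
Qed.

Lemma sph_restS h n : sph_rest h n.+1 = sph_rest h n * sph_cos (h n).
Proof. by rewrite /sph_rest big_ord_recr. Qed.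

Lemma sph_rest0 h : sph_rest h 0 = 1.
Proof. by rewrite /sph_rest big_ord0. Qed.

Lemma sph_norm h n :
  \sum_(l < n) sph_coord h l ^+ 2 = 1 - sph_rest h n ^+ 2.
Proof.
elim: n => [|n IH]; first by rewrite big_ord0 sph_rest0; ring.
rewrite big_ord_recr/= IH sph_restS /sph_coord.
have := sph_pythagoras (h n); move: (sph_sin _) (sph_cos _) => s c sc.
have -> : (s * sph_rest h n) ^+ 2 = s ^+ 2 * sph_rest h n ^+ 2 by ring.
have -> : s ^+ 2 = 1 - c ^+ 2 by lra.
ring.
Qed.

(** Since s^2 + c^2 = s'^2 + c'^2 = 1, one has (s P - s' P')^2 + (c P - c' P')^2 = (P - P')^2 + P P'
    ((s - s')^2 + (c - c')^2), so the remainder of each step is split by the next one. *)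
Lemma sph_dist h (h' : nat -> R) n :
  \sum_(l < n) (sph_coord h l - sph_coord h' l) ^+ 2
    + (sph_rest h n - sph_rest h' n) ^+ 2 =
  \sum_(l < n) ((sph_sin (h l) - sph_sin (h' l)) ^+ 2 +
       (sph_cos (h l) - sph_cos (h' l)) ^+ 2) * (sph_rest h l * sph_rest h' l).
Proof.
elim: n => [|n IH]; first by rewrite !big_ord0 !sph_rest0; ring.
rewrite !big_ord_recr/= -IH !sph_restS /sph_coord.
have := sph_pythagoras (h n); have := sph_pythagoras (h' n).
move: (sph_sin (h n)) (sph_cos (h n)) (sph_sin (h' n)) (sph_cos (h' n)).
move=> s c s' c' sc' sc.
move: (sph_rest h n) (sph_rest h' n) => P P'.
have E : s ^+ 2 = 1 - c ^+ 2 by lra.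
have E' : s' ^+ 2 = 1 - c' ^+ 2 by lra.
rewrite -!addrA; congr (_ + _); ring: E E'.
Qed.

Lemma sph_defect h (h' : nat -> R) n :
  \sum_(l < n) (1 - sph_cos (h l) * sph_cos (h' l)) *
     (sph_rest h l * sph_rest h' l) = 1 - sph_rest h n * sph_rest h' n.
Proof.
elim: n => [|n IH]; first by rewrite !big_ord0 !sph_rest0; ring.
by rewrite big_ord_recr/= IH !sph_restS; ring.
Qed.

Lemma sph_rest_bounds h n : (forall l, 0 <= h l <= 1) -> 0 <= sph_rest h n <= 1.
Proof.
move=> h01; elim: n => [|n IH]; first by rewrite sph_rest0 ler01 lexx.
rewrite sph_restS mulr_ge0 ?sph_cos_ge0//=; last by case/andP: IH.
case/andP: IH => P0 P1; apply: mulr_ile1 => //; first exact: sph_cos_ge0.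
by apply: (le_trans (sph_cos_le1 (h01 n))); rewrite gerBl sqr_ge0.
Qed.

Lemma sph_coord_ge0 h n : (forall l, 0 <= h l <= 1) -> 0 <= sph_coord h n.
Proof.
move=> h01; rewrite mulr_ge0//; last by case/andP: (sph_rest_bounds n h01).
by apply: sph_sin_ge0; case/andP: (h01 n).
Qed.

(* The weights [(1 - c c') \prod c c'] sum to at most 1, as the stopping
   probabilities of a process do; they absorb the relative part of the bound
   on [h - h'], so that only the additive errors [e] accumulate. *)
Lemma sph_dist_le h (h' : nat -> R) e (k : R) n :
  (forall l, 0 <= h l <= 1) -> (forall l, 0 <= h' l <= 1) ->
  (forall l, 0 <= e l) -> 0 <= k ->
  (forall l, (l < n)%N ->
    (h l - h' l) ^+ 2 <= k * (Num.max (h l) (h' l) ^+ 2 + e l)) ->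
  \sum_(l < n) (sph_coord h l - sph_coord h' l) ^+ 2
    <= 4 * k * (1 + \sum_(l < n) e l).
Proof.
move=> h01 h'01 e0 k0 hh.
apply: (@le_trans _ _ (\sum_(l < n) (sph_coord h l - sph_coord h' l) ^+ 2
    + (sph_rest h n - sph_rest h' n) ^+ 2)); first by rewrite lerDl sqr_ge0.
rewrite sph_dist.
apply: (@le_trans _ _ (\sum_(l < n) 4 * k *
  ((1 - sph_cos (h l) * sph_cos (h' l)) * (sph_rest h l * sph_rest h' l) + e l))).
  apply: ler_sum => l _.
  have /andP[P0 P1] := sph_rest_bounds l h01.
  have /andP[P0' P1'] := sph_rest_bounds l h'01.
  have PP0 := mulr_ge0 P0 P0'; have PP1 := mulr_ile1 P0 P0' P1 P1'.
  have ch := sph_chord (h l) (h' l); have hl := hh l (ltn_ord l).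
  (* Each cosine is at most 1 minus the square of its height, and the other cosine is at most 1. *)
  have M : Num.max (h l) (h' l) ^+ 2 <= 1 - sph_cos (h l) * sph_cos (h' l).
    have c0 := sph_cos_ge0 (h01 l); have c1 := sph_cos_le1 (h01 l).
    have c0' := sph_cos_ge0 (h'01 l); have c1' := sph_cos_le1 (h'01 l).
    have := sqr_ge0 (h l); have := sqr_ge0 (h' l).
    by rewrite /Num.max; case: ifP => _; nra.
  have el := e0 l.
  move: (sph_rest h l * sph_rest h' l) PP0 PP1 => P PP0 PP1.
  apply: (@le_trans _ _ (4 * (k * (1 - sph_cos (h l) * sph_cos (h' l) + e l)) * P)).
    apply: ler_wpM2r => //; apply: le_trans ch _.
    by rewrite ler_pM2l// (le_trans hl)// ler_wpM2l// lerD2r.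
  rewrite -!mulrA ler_pM2l// ler_wpM2l// mulrDl lerD2l.
  by rewrite ler_piMr.
rewrite -mulr_sumr big_split/= sph_defect ler_wpM2l ?mulr_ge0//.
rewrite lerD2r gerBl mulr_ge0//.
  by case/andP: (sph_rest_bounds n h01).
by case/andP: (sph_rest_bounds n h'01).
Qed.

(** All coordinates are nonnegative, so dropping the cross terms only increases the sum; each of the
    two vectors has norm at most 1. *)
Lemma sph_dist_le2 h (h' : nat -> R) n :
  (forall l, 0 <= h l <= 1) -> (forall l, 0 <= h' l <= 1) ->
  \sum_(l < n) (sph_coord h l - sph_coord h' l) ^+ 2 <= 2.
Proof.
move=> h01 h'01.
apply: (@le_trans _ _ (\sum_(l < n) (sph_coord h l ^+ 2 + sph_coord h' l ^+ 2))).
  apply: ler_sum => l _; have := sph_coord_ge0 l h01.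
  by have := sph_coord_ge0 l h'01; nra.
rewrite big_split/= !sph_norm; have := sqr_ge0 (sph_rest h n).
by have := sqr_ge0 (sph_rest h' n); lra.
Qed.

End Spherical.

(** * Tent functions with exponential decay *)

Section Bump.
Variable R : realType.
Implicit Types (r : nat) (t : R).

Definition slack r : R := (r.+2%:R)^-1.
Definition rate r : R := ln r.+3%:R.
(** The solution of p' = - [rate] (p + [slack]) with p(0) = 1. The rate ln (r + 3) is the one for
    which p(1) = 0 when the slack is 1 / (r + 2). *)
Definition profile r t := (1 + slack r) * expR (- (rate r * t)) - slack r.
Definition tent r t := Num.max 0 (profile r (Num.max t 1 - 1)).

Lemma slack_gt0 r : 0 < slack r.
Proof. by rewrite invr_gt0 ltr0n. Qed.

Lemma rate_gt0 r : 0 < rate r.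
Proof. by rewrite ln_gt0// ltr1n. Qed.

Lemma tent_ge0 r t : 0 <= tent r t.
Proof. by rewrite le_max lexx. Qed.

Lemma profile0 r : profile r 0 = 1.
Proof. by rewrite /profile mulr0 oppr0 expR0; ring. Qed.

Lemma profile1 r : profile r 1 = 0.
Proof.
rewrite /profile mulr1 expRN /rate lnK ?posrE ?ltr0n// /slack.
rewrite -[in r.+3%:R]addn1 natrD.
have : 0 < r.+2%:R :> R by rewrite ltr0n.
by move=> h; field; apply/andP; split; lra.
Qed.

(** With a = [rate r] (t' - t), the exponential part is multiplied by exp (- a), which lies between
    1 - a and 1. *)
Lemma profileB r t t' : t <= t' ->
  0 <= profile r t - profile r t' <= rate r * (t' - t) * (profile r t + slack r).
Proof.
move=> tt'; rewrite /profile.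
have -> : (1 + slack r) * expR (- (rate r * t')) =
  (1 + slack r) * expR (- (rate r * t)) * expR (- (rate r * (t' - t))).
  by rewrite -mulrA -expRD; congr (_ * expR _); ring.
have : 0 < (1 + slack r) * expR (- (rate r * t)).
  by rewrite mulr_gt0 ?expR_gt0// addr_gt0 ?slack_gt0.
move: (_ * expR (- (rate r * t))) => P P0.
have : 0 <= rate r * (t' - t) by rewrite mulr_ge0 ?(ltW (rate_gt0 _)) ?subr_ge0.
move: (rate r * _) => a a0.
have e1 : expR (- a) <= 1 by rewrite -expR0 ler_expR oppr_le0.
have e2 : 1 - a <= expR (- a) by exact: expR_ge1Dx.
have := ler_wpM2l (ltW P0) e1; have := ler_wpM2l (ltW P0) e2.
by move=> ? ?; apply/andP; split; lra.
Qed.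

Lemma tent_eq1 r t : t <= 1 -> tent r t = 1.
Proof.
by move=> t1; rewrite /tent (max_r t1) subrr profile0 max_r.
Qed.

Lemma tent_eq0 r t : 2 <= t -> tent r t = 0.
Proof.
move=> t2; have t1 : 1 <= t by lra.
rewrite /tent (max_l t1) max_l//.
have u1 : 1 <= t - 1 by lra.
by rewrite -(profile1 r) -subr_ge0; case/andP: (profileB r u1).
Qed.

Lemma tent_le1 r t : tent r t <= 1.
Proof.
have u0 : 0 <= Num.max t 1 - 1 by rewrite subr_ge0 le_max lexx orbT.
by have /andP[+ _] := profileB r u0; rewrite /tent ge_max ler01 profile0 subr_ge0.
Qed.

Lemma tent_lip_le r t t' : t <= t' ->
  0 <= tent r t - tent r t' <= rate r * (t' - t) * (tent r t + slack r).
Proof.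
move=> tt'; set u := Num.max t 1 - 1; set u' := Num.max t' 1 - 1.
have uu' : 0 <= u' - u <= t' - t.
  by rewrite /u /u' /Num.max; case: ifP; case: ifP => *; apply/andP; split; lra.
have rt : 0 <= rate r * (u' - u) <= rate r * (t' - t).
  by rewrite mulr_ge0 ?(ltW (rate_gt0 _)) ?ler_wpM2l ?(ltW (rate_gt0 _))//; case/andP: uu'.
have : u <= u' by case/andP: uu' => + _; rewrite subr_ge0.
move=> /(profileB r); have := slack_gt0 r.
rewrite /tent -/u -/u'; move: (profile r u) (profile r u') (slack r) rt.
move: (rate r * _) (rate r * _) => b a p p' e /andP[a0 ab] e0 /andP[p1 p2].
have [p0|p0] := leP p 0.
  have p'0 : p' <= 0 by lra.
  by rewrite !max_l// subrr lexx add0r mulr_ge0 ?(ltW e0)//; lra.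
have : a * (p + e) <= b * (p + e) by rewrite ler_wpM2r//; lra.
by rewrite /Num.max; case: ifP => ? ?; apply/andP; split; lra.
Qed.

(** The square of [tent_lip_le], with (b + e)^2 <= 2 (b^2 + e^2) separating the relative part from
    the slack, as [sph_dist_le] requires. *)
Lemma tent_lip r t t' :
  (tent r t - tent r t') ^+ 2 <=
    2 * (rate r * (t - t')) ^+ 2 *
      (Num.max (tent r t) (tent r t') ^+ 2 + slack r ^+ 2).
Proof.
wlog tt' : t t' / t <= t'.
  move=> wl; case: (leP t t') => [/wl//|/ltW/wl].
  by rewrite maxC -sqrrN opprB -(sqrrN (rate r * _)) -mulrN opprB.
have /andP[b0 b1] := tent_lip_le r tt'.
rewrite max_l; last by rewrite -subr_ge0.
have b2 := tent_ge0 r t; have e0 := slack_gt0 r.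
apply: (@le_trans _ _ ((rate r * (t' - t) * (tent r t + slack r)) ^+ 2)).
  by rewrite ler_sqr// nnegrE (le_trans b0).
have -> : (rate r * (t - t')) ^+ 2 = (rate r * (t' - t)) ^+ 2 by ring.
rewrite exprMn; have := sqr_ge0 (rate r * (t' - t)).
move: (_ ^+ 2) (tent r t) (slack r) => A b e A0.
rewrite [2 * A]mulrC -mulrA ler_wpM2l//.
by have := sqr_ge0 (b - e); rewrite !expr2; lra.
Qed.

End Bump.

(** * Nets at a fixed scale *)

Section Net.
Variables (R : realType) (d : nat -> nat -> R) (z : int).
Implicit Types (l m a b n p : nat).

Fixpoint net l : seq nat :=
  if l is m.+1 then
    if all (fun p => 2 ^ z < d p m) (net m) then rcons (net m) m else net m
  else [::].

Definition in_net l := all (fun p => 2 ^ z < d p l) (net l).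

(** Only net points preceding l are counted, so the tent of l is fixed once l arrives. The radius 6
    is twice the radius 3 of [height_neq]: two net points that separate the same close pair crowd
    each other. *)
Definition crowd l := size [seq p <- net l | d p l <= 6 * 2 ^ z].

Definition height a l :=
  if in_net l then tent (crowd l) (d l a / 2 ^ z) else 0.

(** The cutoff makes the coordinates of a depend only on points up to a; [netcoordE] shows that it
    changes no value. *)
Definition netcoord a l := if (l <= a)%N then sph_coord (height a) l else 0.

Lemma mem_net n l : (l \in net n) = (l < n)%N && in_net l.
Proof.
elim: n => [|n IH]//=; rewrite ltnS leq_eqVlt -/(in_net n).
case: ifPn => Hn; rewrite ?mem_rcons ?inE IH; case: eqVneq => //= ->.
- by rewrite Hn.
- by rewrite (negbTE Hn) andbF.
Qed.

Lemma net_uniq n : uniq (net n).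
Proof.
elim: n => [|n IH]//=; case: ifP => _ //.
by rewrite rcons_uniq IH mem_net ltnn.
Qed.

Lemma height_bounds a l : 0 <= height a l <= 1.
Proof.
by rewrite /height; case: ifP => _; rewrite ?tent_ge0 ?tent_le1 ?lexx ?ler01.
Qed.

Lemma scale_gt0 : 0 < 2 ^ z :> R.
Proof. by rewrite exprz_gt0. Qed.

Lemma height_eq1 a l : in_net l -> d l a <= 2 ^ z -> height a l = 1.
Proof.
move=> nl dla; rewrite /height nl tent_eq1//.
by rewrite ler_pdivrMr ?scale_gt0// mul1r.
Qed.

Lemma height_eq0 a l : 2 * 2 ^ z <= d l a -> height a l = 0.
Proof.
move=> dla; rewrite /height; case: ifP => // _; rewrite tent_eq0//.
by rewrite ler_pdivlMr ?scale_gt0.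
Qed.

Lemma net_separated l m : in_net l -> in_net m -> (l < m)%N -> 2 ^ z < d l m.
Proof. by move=> nl /allP /(_ l) + lm; rewrite mem_net lm nl; apply. Qed.

Hypothesis dxx : forall a, d a a = 0.
Hypothesis dC : forall a b, d a b = d b a.
Hypothesis dT : forall b a c, d a c <= d a b + d b c.

Lemma net_cover a : exists m, [/\ (m <= a)%N, in_net m & d m a <= 2 ^ z].
Proof.
case: (boolP (in_net a)) => [na|/allPn[m]].
  by exists a; rewrite dxx (ltW scale_gt0).
rewrite mem_net -leNgt => /andP[ma nm] dma.
by exists m; rewrite (ltnW ma).
Qed.

(** The net point covering a has index at most a and height 1 at a, hence contributes a zero
    cosine. *)
Lemma rest_eq0 a n : (a < n)%N -> sph_rest (height a) n = 0.
Proof.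
move=> an; have [m [ma nm dm]] := net_cover a.
have mn : (m < n)%N by exact: leq_ltn_trans ma an.
rewrite /sph_rest (bigD1 (Ordinal mn))//= height_eq1//.
by rewrite /sph_cos expr1n subrr mul0r mul0r.
Qed.

Lemma netcoordE a l : netcoord a l = sph_coord (height a) l.
Proof.
by rewrite /netcoord; case: leqP => // al; rewrite /sph_coord rest_eq0// mulr0.
Qed.

Lemma netcoord_norm a n : (a < n)%N -> \sum_(l < n) netcoord a l ^+ 2 = 1.
Proof.
move=> an; under eq_bigr do rewrite netcoordE.
by rewrite sph_norm rest_eq0//; ring.
Qed.

Lemma netcoord_dist_le2 a b n : \sum_(l < n) (netcoord a l - netcoord b l) ^+ 2 <= 2.
Proof.
under eq_bigr do rewrite !netcoordE.
by apply: sph_dist_le2; exact: height_bounds.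
Qed.

(** No net point is within 2 * 2^z of both points, so the two unit vectors have disjoint supports
    and are orthogonal. *)
Lemma netcoord_dist_far a b n : (a < n)%N -> (b < n)%N -> 4 * 2 ^ z <= d a b ->
  \sum_(l < n) (netcoord a l - netcoord b l) ^+ 2 = 2.
Proof.
move=> an bn dab.
rewrite (eq_bigr (fun l : 'I_n => netcoord a l ^+ 2 + netcoord b l ^+ 2)).
  by rewrite big_split/= !netcoord_norm//; lra.
move=> l _; suff : netcoord a l * netcoord b l = 0 by move=> h; rewrite sqrrB h; ring.
rewrite !netcoordE /sph_coord.
have [la|la] := leP (2 * 2 ^ z) (d l a).
  by rewrite height_eq0// /sph_sin; ring.
have lb : 2 * 2 ^ z <= d l b by have := dT l a b; rewrite (dC a l); lra.
by rewrite (height_eq0 lb) /sph_sin; ring.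
Qed.

(** The heights agree when both points are on the plateau or both are outside the support. Otherwise
    one of them is in the annulus where the tent decays, and the other is at most 2^z further
    away. *)
Lemma height_neq a b l : height a l != height b l -> d a b <= 2 ^ z ->
  [/\ in_net l, d l a <= 3 * 2 ^ z, d l b <= 3 * 2 ^ z &
   2 ^ z < d l a <= 2 * 2 ^ z \/ 2 ^ z < d l b <= 2 * 2 ^ z].
Proof.
move=> hab dab; have nl : in_net l.
  by move: hab; rewrite /height; case: ifP => //; rewrite eqxx.
have s0 := scale_gt0.
have Ta := dT a l b; have Tb := dT b l a; rewrite (dC b a) in Tb.
have n1 : ~ (d l a <= 2 ^ z /\ d l b <= 2 ^ z).
  by move=> [? ?]; move: hab; rewrite !height_eq1// eqxx.
have n2 : ~ (2 * 2 ^ z <= d l a /\ 2 * 2 ^ z <= d l b).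
  by move=> [? ?]; move: hab; rewrite !height_eq0// eqxx.
move: (2 ^ z) (d l a) (d l b) (d a b) s0 Ta Tb n1 n2 dab => s u v w.
move=> s0 Ta Tb n1 n2 ws.
have [us|us] := leP u s; have [vs|vs] := leP v s; first by case: n1.
- by split=> //; try lra; right; apply/andP; split; lra.
- by split=> //; try lra; left; apply/andP; split; lra.
- have [us2|us2] := ltP u (2 * s); first by split=> //; try lra; left; rewrite us ltW.
  have [vs2|vs2] := ltP v (2 * s); last by case: n2.
  by split=> //; try lra; right; rewrite vs ltW.
Qed.

(* The k-th active net point has at least k active, hence crowding,
   predecessors. *)
Lemma sum_slack_le1 a b n : d a b <= 2 ^ z ->
  \sum_(l < n | height a l != height b l) slack R (crowd l) ^+ 2 <= 1.
Proof.
move=> dab; pose act l := height a l != height b l.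
(* With J active points so far, the next slack is at most 1 / (J + 2), and 1 / (J + 2)^2 <= 1 / (J +
   1) - 1 / (J + 2) makes the bound telescope. *)
suff : \sum_(l < n | act l) slack R (crowd l) ^+ 2 <=
    1 - (count act (iota 0 n)).+1%:R^-1.
  by move/le_trans; apply; rewrite gerBl invr_ge0.
elim: n => [|n IH]; first by rewrite big_ord0 /= invr1 subrr.
have -> : iota 0 n.+1 = iota 0 n ++ [:: n] by rewrite -addn1 iotaD.
rewrite count_cat big_mkcond big_ord_recr -big_mkcond/= addn0.
case: ifPn => [an|_]; last by rewrite addr0 addn0.
rewrite addn1; set J := count act (iota 0 n) in IH *.
have Jn : (J <= crowd n)%N.
  rewrite /J -size_filter; apply: uniq_leq_size; first exact/filter_uniq/iota_uniq.
  move=> m; rewrite !mem_filter mem_iota add0n mem_net /= => /andP[am mn].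
  have [nm ma mb _] := height_neq am dab.
  have [nn na nb _] := height_neq an dab.
  by rewrite nm mn/= andbT; have := dT a m n; rewrite (dC a n); lra.
have : slack R (crowd n) ^+ 2 <= J.+2%:R^-1 ^+ 2.
  by rewrite ler_sqr ?nnegrE ?invr_ge0// lef_pV2 ?posrE// ler_nat.
have : J.+1%:R^-1 - J.+2%:R^-1 = J.+1%:R^-1 * J.+2%:R^-1 :> R.
  have J1 : 0 < J.+1%:R :> R by rewrite ltr0n.
  by rewrite -[J.+2%:R]natr1; field; apply/andP; split; apply: lt0r_neq0; lra.
have : J.+2%:R^-1 <= J.+1%:R^-1 :> R by rewrite lef_pV2 ?posrE// ler_nat.
have : 0 < J.+2%:R^-1 :> R by rewrite invr_gt0.
move: (J.+2%:R^-1) (J.+1%:R^-1) IH => u v; nra.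
Qed.

Lemma netcoord_dist_eq0 a b n : (forall l, (l < n)%N -> height a l = height b l) ->
  \sum_(l < n) (netcoord a l - netcoord b l) ^+ 2 = 0.
Proof.
move=> hab; rewrite big1// => l _; rewrite !netcoordE /sph_coord.
have -> : sph_rest (height a) l = sph_rest (height b) l.
  by apply: eq_bigr => m _; rewrite hab// (ltn_trans (ltn_ord m)).
by rewrite hab//; ring.
Qed.

Lemma netcoord_dist_near a b n (K : R) : d a b <= 2 ^ z ->
  (forall l, (l < n)%N -> in_net l -> rate R (crowd l) <= K) ->
  \sum_(l < n) (netcoord a l - netcoord b l) ^+ 2 <= 16 * (K * (d a b / 2 ^ z)) ^+ 2.
Proof.
move=> dab HK; under eq_bigr do rewrite !netcoordE.
have s0 := scale_gt0.
(* The slack is charged only at active net points, where the sum of its squares is at most 1;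
   [sph_dist_le] then gives 4 k (1 + 1). *)
pose e l : R := if height a l != height b l then slack R (crowd l) ^+ 2 else 0.
have e0 l : 0 <= e l by rewrite /e; case: ifP => // _; exact: sqr_ge0.
set k := 2 * (K * (d a b / 2 ^ z)) ^+ 2.
have k0 : 0 <= k by rewrite mulr_ge0// sqr_ge0.
have e1 : \sum_(l < n) e l <= 1.
  by rewrite -big_mkcond/=; exact: sum_slack_le1.
apply: le_trans (sph_dist_le (k := k) (e := e) _ _ e0 k0 _) _.
- exact: height_bounds.
- exact: height_bounds.
- move=> l ln; rewrite /e; case: (eqVneq (height a l) (height b l)) => [->|hab].
    by rewrite subrr expr0n/= mulr_ge0// addr0 sqr_ge0.
  have [nl _ _ _] := height_neq hab dab.
  rewrite /height nl; apply: le_trans (tent_lip _ _ _) _.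
  apply: ler_wpM2r; first by rewrite addr_ge0// sqr_ge0.
  rewrite /k ler_pM2l// -mulrBl !exprMn.
  have r0 := rate_gt0 R (crowd l); have rK := HK l ln nl.
  apply: ler_pM; [exact: sqr_ge0|by rewrite mulr_ge0 ?sqr_ge0| |].
    by rewrite ler_sqr// nnegrE; lra.
  apply: ler_wpM2r; first exact: sqr_ge0.
  have := dT l a b; have := dT a l b; have := dT b l a.
  rewrite (dC b a) (dC a l) => h1 h2 h3; nra.
- rewrite /k; have := sqr_ge0 (K * (d a b / 2 ^ z)).
  move: (_ ^+ 2) e1 => u; nra.
Qed.

End Net.

(** * Packing in doubling spaces *)

Section Doubling.
Variables (R : realType) (X : metricType R).
Implicit Types (S : set X) (D : R) (c u v w : X).

Lemma ln_nat_le_pow2 D m : (m%:R <= 2 `^ D :> R) -> (0 < m)%N ->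
  ln m%:R <= D * ln 2 :> R.
Proof.
by move=> mD m0; rewrite -ln_powR ler_ln// posrE ?ltr0n// powR_gt0.
Qed.

Lemma ln2_bounds : 0 < (ln 2 : R) <= 1.
Proof.
rewrite ln_gt0 ?ltr1n//=; have -> : 2 = 1 + 1 :> R by ring.
by apply: le_ln1Dx; lra.
Qed.

Lemma ddim_ge0 S D u : has_ddim S D -> S u -> 0 <= D.
Proof.
move=> /(_ u 1) + Su => /(_ Su ltr01)[s [sD _ cov]].
have [|y ys _] := cov u.
  by split=> //; rewrite ballEmdist/= mdistxx mulr1.
have s0 : (0 < size s)%N by case: (s) ys.
have := ln_nat_le_pow2 sD s0; have /andP[l0 l1] := ln2_bounds.
have : 0 <= ln (size s)%:R :> R by rewrite ln_ge0// ler1n.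
by move=> h1 h2; rewrite -(pmulr_lge0 _ l0); lra.
Qed.

(** Let r be the smallest positive distance. An open ball of radius r centered in the range holds a
    single point, so two such balls are needed to cover the ball of radius 2 r around one end of a
    closest pair. *)
Lemma ddim_ge1 n (x : 'I_n -> X) D i j : has_ddim (range x) D ->
  x i != x j -> 1 <= D.
Proof.
move=> hD xij.
have [p px pmin] := @Order.TotalTheory.arg_minP _ R _ (i, j)
  (fun p : 'I_n * 'I_n => x p.1 != x p.2) (fun p => mdist (x p.1) (x p.2)) xij.
set r := mdist _ _ in pmin.
have r0 : 0 < r by rewrite mdist_gt0.
have Sx k : range x (x k) by exists k.
have [s [sD sS cov]] := hD (x p.1) r (Sx _) r0.
have xs k : mdist (x p.1) (x k) < 2 * r -> x k \in s.
  move=> dk; have [|y ys] := cov (x k).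
    by split=> //; rewrite ballEmdist.
  have [k' _ yk] := sS y ys; rewrite -{y}yk in ys *; rewrite ballEmdist/= => dkk.
  apply/negPn/negP => xkNs; have nkk : x k' != x k.
    by apply: contraNneq xkNs => <-; exact: ys.
  by move: dkk; rewrite ltNge (pmin (k', k)).
have s2 : (2 <= size s)%N.
  rewrite -[2%N]/(size [:: x p.1; x p.2]); apply: uniq_leq_size.
    by rewrite /= inE px.
  move=> y; rewrite !inE => /orP[]/eqP->; apply: xs.
    by rewrite mdistxx mulr_gt0.
  by rewrite -/r; lra.
have s0 : (0 < size s)%N by exact: leq_trans s2.
have := ln_nat_le_pow2 sD s0; have /andP[l0 l1] := ln2_bounds.
have : ln 2 <= ln (size s)%:R :> R.
  by rewrite ler_ln ?posrE ?ltr0n// ler_nat.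
by move=> h1 h2; rewrite -(ler_pM2r l0) mul1r; lra.
Qed.

Lemma ddim_cover S D k c (r : R) : has_ddim S D -> S c -> 0 < r ->
  exists s : seq X, [/\ (size s)%:R <= (2 `^ D) ^+ k,
    forall y, y \in s -> S y &
    forall w, S w -> mdist c w < 2 ^+ k * r -> exists2 y, y \in s & mdist y w < r].
Proof.
move=> hD + r0; have B0 : 0 <= 2 `^ D :> R by exact: powR_ge0.
elim: k c => [|k IH] c Sc.
  exists [:: c]; rewrite expr0 lexx; split=> // [y|w Sw].
    by rewrite inE => /eqP->.
  by rewrite expr0 mul1r => cw; exists c; rewrite ?inE.
have [s0 [s0D s0S cov0]] := hD c (2 ^+ k * r) Sc (mulr_gt0 (exprn_gt0 _ (ltr0Sn _ _)) r0).
(* The covers of the balls around the centers in [s0] are concatenated, by induction on [s0]. *)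
suff : exists s : seq X, [/\ (size s)%:R <= (size s0)%:R * (2 `^ D) ^+ k,
    forall y, y \in s -> S y &
    forall y w, y \in s0 -> S w -> mdist y w < 2 ^+ k * r ->
      exists2 y, y \in s & mdist y w < r].
  move=> [s [sz sS cov]]; exists s; split=> //.
    by rewrite (le_trans sz)// exprS ler_wpM2r// exprn_ge0.
  move=> w Sw cw; have [|y ys] := cov0 w.
    by split=> //; rewrite ballEmdist/= mulrA -exprS.
  by rewrite ballEmdist => yw; exact: (cov y).
elim: s0 s0S {s0D cov0} => [_|y0 s0 IHs sS]; first by exists [::]; rewrite mul0r.
have [|s [sz sS' cov]] := IHs; first by move=> y ys; apply: sS; rewrite /= inE ys orbT.
have [|t [tz tS tcov]] := IH y0; first by apply: sS; rewrite /= mem_head.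
exists (t ++ s); split.
- by rewrite size_cat natrD /= -[(size s0).+1]add1n natrD mulrDl mul1r lerD.
- by move=> y; rewrite mem_cat => /orP[/tS|/sS'].
- move=> y w; rewrite inE => /orP[/eqP->|ys] Sw yw.
    by have [v vt vw] := tcov w Sw yw; exists v; rewrite ?mem_cat ?vt.
  by have [v vt vw] := cov y w ys Sw yw; exists v; rewrite ?mem_cat ?vt ?orbT.
Qed.

(** Pigeonhole on the cover: two points at distance at least 2 r cannot lie in the same open ball of
    radius r. *)
Lemma ddim_packing S D k c (r : R) (t : seq X) : has_ddim S D -> S c -> 0 < r ->
  uniq t ->
  (forall u, u \in t -> S u /\ mdist c u < 2 ^+ k * r) ->
  (forall u v, u \in t -> v \in t -> u != v -> 2 * r <= mdist u v) ->
  (size t)%:R <= (2 `^ D) ^+ k.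
Proof.
move=> hD Sc r0 ut tS sep.
have [s [sD _ cov]] := ddim_cover k hD Sc r0.
apply: le_trans sD; rewrite ler_nat.
have /choice[f fP] : forall u, exists y, u \in t -> y \in s /\ mdist y u < r.
  move=> u; have [ut'|] := boolP (u \in t); last by exists c.
  by have [Su du] := tS u ut'; have [y ys yu] := cov u Su du; exists y.
rewrite -(size_map f); apply: uniq_leq_size; last first.
  by move=> y /mapP[u ut' ->]; have [] := fP u ut'.
rewrite map_inj_in_uniq// => u v utt vtt fuv; apply: contrapT => /eqP uv.
have := sep u v utt vtt uv; apply/negP; rewrite -ltNge.
have [_ du] := fP u utt; have [_ dv] := fP v vtt; rewrite fuv in du.
by have := metric_triangle u (f v) v; rewrite (metric_sym u (f v)); lra.
Qed.

Lemma rate_crowd_le S D (y : nat -> X) (z : int) l :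
  has_ddim S D -> 1 <= D -> (forall p, S (y p)) ->
  let d p q := mdist (y p) (y q) in
  in_net d z l -> rate R (crowd d z l) <= 6 * D.
Proof.
move=> hD D1 yS d nl; set C := crowd d z l; have s0 := scale_gt0 R z.
pose t := l :: [seq p <- net d z l | d p l <= 6 * 2 ^ z].
have tP p : p \in t -> in_net d z p /\ d l p <= 6 * 2 ^ z.
  rewrite inE mem_filter mem_net => /orP[/eqP->|/and3P[dp _ np]].
    by split=> //; rewrite /d mdistxx mulr_ge0// ltW.
  by split=> //; rewrite /d metric_sym.
have sep p q : p \in t -> q \in t -> p != q -> 2 ^ z < d p q.
  move=> /tP[np _] /tP[nq _]; rewrite neq_ltn => /orP[pq|qp].
    exact: net_separated np nq pq.
  by rewrite /d metric_sym; exact: net_separated nq np qp.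
have ut : uniq (map y t).
  rewrite map_inj_in_uniq; last first.
    move=> p q pt qt yy; apply: contrapT => /eqP pq.
    by have := sep p q pt qt pq; rewrite /d yy mdistxx ltNge ltW.
  by rewrite /= filter_uniq ?net_uniq// mem_filter mem_net ltnn andbF.
(* With r = 2^z / 2 the separation is 2 r and 6 * 2^z < 2^4 r, so packing applies with four
   doublings. *)
have h2 : 0 < 2 ^ z / 2 :> R by rewrite divr_gt0.
have Ct : (C.+1)%:R <= (2 `^ D) ^+ 4 :> R.
  have -> : C.+1 = size (map y t) by rewrite size_map.
  apply: (ddim_packing hD (yS l) h2 ut) => [u /mapP[p pt ->]|u v].
    by split=> //; have [_] := tP p pt; rewrite /d; lra.
  move=> /mapP[p pt ->] /mapP[q qt ->] yy.
  have pq : p != q by apply: contraNneq yy => ->.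
  by have := sep p q pt qt pq; rewrite /d; lra.
have /andP[l0 l1] := ln2_bounds.
have B2 : 2 <= 2 `^ D :> R.
  by rewrite -[leLHS](powRr1 (ler0n R 2)) ler_powR// ler1n.
(* Two further factors 2^D >= 2 absorb the shift from C + 1 to C + 3. *)
have : C.+3%:R <= (2 `^ D) ^+ 6 :> R.
  have -> : C.+3%:R = C.+1%:R + 2 :> R by rewrite -natrD addn2.
  rewrite (exprD _ 4 2); move: Ct; set b := 2 `^ D in B2 *.
  have b2 : 4 <= b ^+ 2 by nra.
  have b4 : 1 <= b ^+ 4 by rewrite exprn_ege1//; lra.
  move: (b ^+ 4) (b ^+ 2) b4 b2 => u v; nra.
rewrite /rate -ler_ln ?posrE ?ltr0n ?exprn_gt0 ?powR_gt0//.
move/le_trans; apply; rewrite lnXn ?powR_gt0// ln_powR -[leLHS]mulr_natl ler_pM2l//.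
by rewrite ler_piMr//; lra.
Qed.

End Doubling.

(** * Summation over the scales *)

Section PickledSums.
Variable R : realType.
Implicit Types (G : int * nat -> R) (z : int).

Lemma sum_iota n (F : nat -> R) : \sum_(i <- iota 0 n) F i = \sum_(i < n) F i.
Proof. by rewrite -(big_mkord xpredT) /index_iota subn0. Qed.

Lemma ler_sum_subset (T : eqType) (s t : seq T) (F : T -> R) :
  (forall p, 0 <= F p) -> uniq s -> uniq t -> {subset s <= t} ->
  \sum_(p <- s) F p <= \sum_(p <- t) F p.
Proof.
move=> F0 us ut st; rewrite [leRHS](bigID (mem s))/= -[X in _ <= X + _]big_filter.
rewrite (perm_big [seq p <- t | p \in s]); first by rewrite lerDl sumr_ge0.
apply: uniq_perm => //; first exact: filter_uniq.
by move=> p; rewrite mem_filter; case: (boolP (p \in s)) => //= /st.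
Qed.

(** Reads a family indexed by scale and net point as a sequence, through the countable encoding of
    pairs; [t0] fills the indices that encode no pair. *)
Definition unpair (T : Type) (G : int * nat -> T) (t0 : T) (k : nat) : T :=
  oapp G t0 (@pickle_inv (int * nat)%type k).

Lemma unpair_sum_le G n (B : R) : (forall p, 0 <= G p) ->
  (forall z l, (n <= l)%N -> G (z, l) = 0) ->
  (forall M m : nat, \sum_(i < m) \sum_(l < n) G (i%:Z - M%:Z, l : nat) <= B) ->
  forall N, \sum_(k < N) unpair G 0 k <= B.
Proof.
move=> G0 Gn GB N; set s := pmap (@pickle_inv (int * nat)%type) (iota 0 N).
have -> : \sum_(k < N) unpair G 0 k = \sum_(p <- s) G p.
  rewrite -sum_iota /s.
  elim: (iota 0 N) => [|k t IH]; first by rewrite !big_nil.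
  rewrite big_cons IH /= /unpair; case: pickle_inv => [p|] /=.
    by rewrite big_cons.
  by rewrite add0r.
have us : uniq s by apply: pmap_uniq (iota_uniq _ _); exact: pickle_invK.
(* All scales met by the first N codes lie in [-M, M], so these codes fit in a box of 2 M + 1
   shifted scales. *)
pose M := \max_(p <- s) `|p.1|%N.
pose t := [seq (i%:Z - M%:Z, l) | i <- iota 0 (M + M).+1, l <- iota 0 n].
apply: le_trans (GB M (M + M).+1).
have -> : \sum_(i < (M + M).+1) \sum_(l < n) G (i%:Z - M%:Z, l : nat) =
    \sum_(p <- t) G p.
  rewrite big_allpairs_dep.
  by rewrite sum_iota; apply: eq_bigr => i _; rewrite sum_iota.
rewrite (bigID (fun p => (p.2 < n)%N))/= [X in _ + X]big1 ?addr0; last first.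
  by move=> [z l]; rewrite -leqNgt; exact: Gn.
rewrite -big_filter; apply: ler_sum_subset => //.
- exact: filter_uniq.
- apply: allpairs_uniq; [exact: iota_uniq|exact: iota_uniq|].
  by move=> [i l] [i' l'] _ _ /= [] ii' ->; congr (_, _); lia.
- move=> [z l]; rewrite mem_filter /= => /andP[ln zs]; apply/allpairsP.
  have : (`|z| <= M)%N by exact: (@leq_bigmax_seq _ s xpredT (fun p => `|p.1|%N) (z, l)).
  move=> zM; exists (absz (z + M%:Z)%R, l); split.
  + by rewrite mem_iota /=; lia.
  + by rewrite mem_iota /=; lia.
  + by rewrite /= gez0_abs ?addrK//; lia.
Qed.

Lemma unpair_sum_ge G z n : (forall p, 0 <= G p) ->
  exists N, \sum_(l < n) G (z, l : nat) <= \sum_(k < N) unpair G 0 k.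
Proof.
move=> G0; pose f (l : nat) := pickle (z, l).
exists (\max_(l < n) f l).+1; set N := _.+1.
have -> : \sum_(l < n) G (z, l : nat) =
    \sum_(k <- map f (iota 0 n)) unpair G 0 k.
  rewrite big_map sum_iota; apply: eq_bigr => l _.
  by rewrite /unpair /f pickleK_inv.
rewrite -sum_iota; apply: ler_sum_subset => [k|||k].
- by rewrite /unpair; case: pickle_inv => /=.
- rewrite map_inj_uniq ?iota_uniq// => l l' /(pcan_inj pickleK)[].
  by [].
- by exact: iota_uniq.
- move=> /mapP[l]; rewrite !mem_iota !add0n /= => ln ->.
  by rewrite /N ltnS (@leq_bigmax _ (fun l : 'I_n => f l) (Ordinal ln)).
Qed.

End PickledSums.

Section Scales.
Variable R : realType.

Lemma sum_small_scales (m M : nat) (r : R) : 0 <= r ->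
  \sum_(i < m | 2 ^ (i%:Z - M%:Z) < r) (2 ^ (i%:Z - M%:Z)) ^+ 2 <= 4 / 3 * r ^+ 2.
Proof.
move=> r0; suff : \sum_(i < m | 2 ^ (i%:Z - M%:Z) < r) (2 ^ (i%:Z - M%:Z)) ^+ 2
    <= Num.min ((2 ^ (m%:Z - M%:Z)) ^+ 2 / 3) (4 / 3 * r ^+ 2) :> R.
  by rewrite le_min => /andP[].
elim: m => [|m IH]; rewrite le_min.
  rewrite big_ord0 divr_ge0 ?sqr_ge0//=.
  by rewrite mulr_ge0 ?sqr_ge0.
rewrite big_mkcond big_ord_recr -big_mkcond /=.
move: IH; rewrite le_min => /andP[].
have -> : 2 ^ (m.+1%:Z - M%:Z) = 2 * 2 ^ (m%:Z - M%:Z) :> R.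
  by rewrite -[X in X * _]expr1z -expfzDr//; congr (_ ^ _); lia.
have := scale_gt0 R (m%:Z - M%:Z).
move: (\sum_(i < m | _) _) (2 ^ _) => S s s0 S1 S2.
by case: ifP => sr; apply/andP; split; nra.
Qed.

Lemma scale_le (z z' : int) : (2 ^ z <= 2 ^ z' :> R) = (z <= z').
Proof. by rewrite ler_eXz2l// ltr1n. Qed.

Lemma scale_lt_double (z z' : int) : z < z' -> 2 * 2 ^ z <= 2 ^ z' :> R.
Proof. by move=> zz; rewrite -[X in X * _]expr1z -expfzDr// scale_le; lia. Qed.

(** The extreme scales of the window have ratio at most hi / lo, so there are at most 1 + log2 (hi /
    lo) of them; the truncation in [log_bound] absorbs the 1. *)
Lemma card_scales_log (m M : nat) (lo hi : R) : 0 < lo ->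
  #|[pred i : 'I_m | lo <= 2 ^ (i%:Z - M%:Z) < hi]|%:R <= 2 * log_bound (hi / lo).
Proof.
move=> lo0; set I := [pred i : 'I_m | _].
have b1 : 1 <= log_bound (hi / lo) by rewrite le_max lexx.
have [i iI|I0] := pickP I; last by rewrite eq_card0//; lra.
have [i0 i0I min0] := @arg_minnP _ i I id iI.
have [i1 i1I max1] := @arg_maxnP _ i I id iI.
have i01 : (i0 <= i1)%N by exact: min0.
have cI : (#|I| <= (i1 - i0).+1)%N.
  rewrite cardE -(size_map val) -(size_iota i0 (i1 - i0).+1).
  apply: uniq_leq_size; first by rewrite map_inj_uniq ?enum_uniq//; exact: val_inj.
  move=> k /mapP[j]; rewrite mem_enum => jI ->; rewrite mem_iota.
  by have := min0 j jI; have := max1 j jI; rewrite /=; lia.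
have hi0 : 0 < hi.
  by move: iI; rewrite /I/= => /andP[_]; apply: lt_trans; exact: scale_gt0.
have : (i1 - i0)%:R * ln 2 <= ln (hi / lo).
  rewrite mulr_natl -lnXn ?ltr0n// ler_ln ?posrE ?exprn_gt0 ?divr_gt0//.
  rewrite ler_pdivlMr//.
  move: i0I i1I; rewrite /I/= => /andP[l0 _] /andP[_ /ltW]; apply: le_trans.
  have -> : (i1%:Z - M%:Z) = (i1 - i0)%:Z + (i0%:Z - M%:Z) by lia.
  by rewrite expfzDr// -exprnP ler_wpM2l// exprn_ge0.
have /andP[l0 _] := ln2_bounds R; rewrite -ler_pdivlMr// => hl.
have h2 : ln (hi / lo) / ln 2 <= log_bound (hi / lo) by rewrite le_max lexx orbT.
have : #|I|%:R <= (i1 - i0)%:R + 1 :> R by rewrite natr1 ler_nat.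
by lra.
Qed.

End Scales.

(** * Dependence on the distances seen so far *)

Section Locality.
Variables (R : realType) (d d' : nat -> nat -> R) (z : int) (a : nat).
Hypothesis dd' : forall p q, (p <= a)%N -> (q <= a)%N -> d p q = d' p q.

Lemma net_local l : (l <= a.+1)%N -> net d z l = net d' z l.
Proof.
elim: l => [|l IH]//= la; rewrite IH 1?ltnW//.
congr (if _ then _ else _); apply: eq_in_all => p; rewrite mem_net => /andP[pl _].
by rewrite dd'// (leq_trans (ltnW pl)).
Qed.

Lemma height_local l : (l <= a)%N -> height d z a l = height d' z a l.
Proof.
move=> la; have E : net d z l = net d' z l by rewrite net_local// ltnW.
have pl p : p \in net d' z l -> d p l = d' p l.
  by rewrite mem_net => /andP[pl _]; rewrite dd'// (leq_trans (ltnW pl)).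
rewrite /height /in_net /crowd E dd'//; congr (if _ then tent _ _ else _).
  by apply: eq_in_all => p /pl->.
by congr size; apply: eq_in_filter => p /pl->.
Qed.

Lemma netcoord_local l : netcoord d z a l = netcoord d' z a l.
Proof.
rewrite /netcoord; case: leqP => // la; rewrite /sph_coord height_local//.
congr (_ * _); apply: eq_bigr => m _; rewrite height_local//.
exact: leq_trans (ltnW (ltn_ord m)) la.
Qed.

End Locality.

Lemma exists_scale (R : realType) (r : R) : 0 < r ->
  exists z : int, 2 ^ z <= r < 2 * 2 ^ z.
Proof.
move=> r0; have /andP[l0 _] := ln2_bounds R.
pose t := ln r / ln 2; have rE : r = 2 `^ t.
  by rewrite /powR pnatr_eq0/= /t divfK ?gt_eqF// lnK.
exists (Num.floor t); have E (z : int) : 2 ^ z = 2 `^ z%:~R :> R.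
  by rewrite powR_intmul.
rewrite -[X in X * _]expr1z -expfzDr// !E rE; apply/andP; split.
  by rewrite ler_powR ?ler1n// floor_le.
by rewrite /powR pnatr_eq0/= ltr_expR ltr_pM2r// addrC floorD1_gt.
Qed.

(** * Orthogonal sum over the scales *)

Section Embedding.
Variables (R : realType) (d : nat -> nat -> R).
Implicit Types (a b n l : nat) (z : int).

(* Subtracting the image of the first point makes the large scales, where all
   points share the same coordinates, vanish. *)
Definition embed a : nat -> R :=
  unpair (fun p => 2 ^ p.1 * (netcoord d p.1 a p.2 - netcoord d p.1 0 p.2)) 0.

Definition sqr_diff a b (p : int * nat) : R :=
  (2 ^ p.1 * (netcoord d p.1 a p.2 - netcoord d p.1 b p.2)) ^+ 2.

Lemma embedB_sqr a b k :
  (embed a k - embed b k) ^+ 2 = unpair (sqr_diff a b) 0 k.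
Proof.
rewrite /embed /unpair; case: pickle_inv => [p|]/=; last by ring.
by rewrite /sqr_diff; ring.
Qed.

Lemma embed0 k : embed 0 k = 0.
Proof.
by rewrite /embed /unpair; case: pickle_inv => //= p; rewrite subrr mulr0.
Qed.

(** The scales at or above the distance of a and b at which some tent separates them; all other
    scales at or above it contribute nothing. *)
Definition active a b n z :=
  (d a b <= 2 ^ z) && has (fun l => height d z a l != height d z b l) (iota 0 n).

Hypothesis dxx : forall a, d a a = 0.
Hypothesis dC : forall a b, d a b = d b a.
Hypothesis dT : forall b a c, d a c <= d a b + d b c.

Lemma activeP a b n z : active a b n z -> d a b <= 2 ^ z /\
  exists c : bool, exists l : 'I_n,
    2 ^ z < d l (if c then a else b) <= 2 * 2 ^ z.
Proof.
move=> /andP[dab /hasP[l]]; rewrite mem_iota add0n /= => ln hab; split=> //.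
have [_ _ _ [?|?]] := height_neq dC dT hab dab.
  by exists true, (Ordinal ln).
by exists false, (Ordinal ln).
Qed.

(** An active scale is mapped to an end of the pair and a point l in its annulus. The half-open
    annuli of distinct scales are disjoint, so this map is injective. *)
Lemma card_active_le a b n (m M : nat) :
  (#|[pred i : 'I_m | active a b n (i%:Z - M%:Z)]| <= 2 * n)%N.
Proof.
set I := [pred i : 'I_m | _].
have [i0 i0I|I0] := pickP I; last by rewrite eq_card0.
have [_ [c0 [l0 _]]] := activeP i0I.
have /choice[f fP] : forall i : 'I_m, exists p : bool * 'I_n, i \in I ->
    2 ^ (i%:Z - M%:Z) < d p.2 (if p.1 then a else b) <= 2 * 2 ^ (i%:Z - M%:Z).
  move=> i; have [/activeP[_ [c [l cl]]]|] := boolP (i \in I).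
    by exists (c, l).
  by exists (c0, l0).
have fI : {in I &, injective f}.
  move=> i j iI jI fij; have := fP i iI; have := fP j jI; rewrite {}fij.
  move=> /andP[j1 j2] /andP[i1 i2]; apply: val_inj.
  have [ij|ji|//] := ltngtP (val i) (val j).
    have : i%:Z - M%:Z < j%:Z - M%:Z by move: ij => /=; lia.
    by move=> {ij} /(scale_lt_double R) h; exfalso; lra.
  have : j%:Z - M%:Z < i%:Z - M%:Z by move: ji => /=; lia.
  by move=> {ji} /(scale_lt_double R) h; exfalso; lra.
have -> : (2 * n)%N = #|{: bool * 'I_n}| by rewrite card_prod card_bool card_ord.
by rewrite -(card_in_image fI); exact: max_card.
Qed.

Lemma embed_dist_le a b n (K T : R) : (a < n)%N -> (b < n)%N ->
  (forall z l, in_net d z l -> (l < n)%N -> rate R (crowd d z l) <= K) ->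
  (forall m M : nat,
     #|[pred i : 'I_m | active a b n (i%:Z - M%:Z)]|%:R <= T) ->
  forall N, \sum_(k < N) (embed a k - embed b k) ^+ 2 <=
    (8 / 3 + 16 * K ^+ 2 * T) * d a b ^+ 2.
Proof.
move=> an bn HK HT N; under eq_bigr do rewrite embedB_sqr.
have dab0 : 0 <= d a b by have := dT b a a; rewrite dxx (dC b a); lra.
apply: (@unpair_sum_le _ _ n) => [p|z l nl|M m]; first exact: sqr_ge0.
  have [la lb] : (l <= a)%N = false /\ (l <= b)%N = false by lia.
  rewrite /sqr_diff /netcoord/= la lb.
  by rewrite subrr mulr0 expr0n.
pose s (i : 'I_m) : R := 2 ^ (i%:Z - M%:Z).
have s0 i : 0 < s i by exact: scale_gt0.
pose A := [pred i : 'I_m | active a b n (i%:Z - M%:Z)].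
(* A scale s below the distance costs at most 2 s^2, which sums to 8 / 3 of the squared distance. At
   an active scale, s^2 cancels against the Lipschitz bound. *)
apply: (@le_trans _ _ (\sum_(i < m)
   ((if s i < d a b then 2 * s i ^+ 2 else 0) +
    (if A i then 16 * K ^+ 2 * d a b ^+ 2 else 0)))).
  apply: ler_sum => i _.
  have -> : \sum_(l < n) sqr_diff a b (i%:Z - M%:Z, l : nat) = s i ^+ 2 *
      \sum_(l < n) (netcoord d (i%:Z - M%:Z) a l - netcoord d (i%:Z - M%:Z) b l) ^+ 2.
    by rewrite mulr_sumr; apply: eq_bigr => l _; rewrite /sqr_diff exprMn.
  have K0 : 0 <= 16 * K ^+ 2 * d a b ^+ 2.
    by rewrite mulr_ge0 ?sqr_ge0// mulr_ge0 ?sqr_ge0.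
  case: ltP => sd.
    rewrite (@le_trans _ _ (2 * s i ^+ 2))//.
      by rewrite mulrC ler_wpM2r ?sqr_ge0//; exact: netcoord_dist_le2.
    by rewrite lerDl; case: ifP.
  rewrite add0r; case: ifPn => [_|]; last first.
    rewrite /A /= /active sd /= => /hasPn h.
    rewrite netcoord_dist_eq0 ?mulr0// => l ln; apply/eqP.
    by have := h l; rewrite mem_iota ln negbK; apply.
  have := netcoord_dist_near dxx dC dT (n := n) (K := K) sd.
  move=> /(_ (fun l ln nl => HK _ l nl ln)) h.
  have -> : 16 * K ^+ 2 * d a b ^+ 2 = s i ^+ 2 * (16 * (K * (d a b / s i)) ^+ 2).
    by field; exact: lt0r_neq0.
  by rewrite ler_wpM2l ?sqr_ge0.
rewrite big_split/= -!big_mkcond/= -mulr_sumr sumr_const [leRHS]mulrDl.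
apply: lerD; first by have := sum_small_scales m M dab0; rewrite /s; lra.
rewrite -[leLHS]mulr_natr.
rewrite [leLHS](_ : _ = 16 * K ^+ 2 * #|A|%:R * d a b ^+ 2); last first.
  by rewrite mulrAC.
apply: ler_wpM2r; first exact: sqr_ge0.
apply: ler_wpM2l; first by rewrite mulr_ge0 ?sqr_ge0.
exact: (HT m M).
Qed.

(** One scale suffices: if 2^z <= d a b / 4 < 2 * 2^z, the coordinates at scale z are orthogonal and
    give 2 * 4^z, while the squared distance is below 64 * 4^z <= 36 * 2 * 4^z. *)
Lemma embed_dist_ge a b : 0 < d a b ->
  exists N, d a b ^+ 2 <= 36 * \sum_(k < N) (embed a k - embed b k) ^+ 2.
Proof.
move=> dab; have d4 : 0 < d a b / 4 by lra.
have [z /andP[z1 z2]] := exists_scale d4; have s0 := scale_gt0 R z.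
pose n := (maxn a b).+1.
have [N HN] := @unpair_sum_ge R (sqr_diff a b) z n (fun p => sqr_ge0 _).
exists N; under eq_bigr do rewrite embedB_sqr.
apply: (@le_trans _ _ (36 * \sum_(l < n) sqr_diff a b (z, l : nat))); last first.
  by rewrite ler_pM2l.
have -> : \sum_(l < n) sqr_diff a b (z, l : nat) = (2 ^ z) ^+ 2 *
    \sum_(l < n) (netcoord d z a l - netcoord d z b l) ^+ 2.
  by rewrite mulr_sumr; apply: eq_bigr => l _; rewrite /sqr_diff exprMn.
rewrite netcoord_dist_far// ?ltnS ?leq_maxl ?leq_maxr//; last by lra.
by move: (2 ^ z) s0 z1 z2 => s; nra.
Qed.

Lemma crowd_le z l : (crowd d z l <= l)%N.
Proof.
rewrite /crowd size_filter (leq_trans (count_size _ _))//.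
by elim: l => //= l IH; case: ifP => _; rewrite ?size_rcons// leqW.
Qed.

(** A crude bound free of any doubling assumption. It yields square-summability, and equal images
    for equal points. *)
Lemma embed_dist_finite a b : exists B : R,
  forall N, \sum_(k < N) (embed a k - embed b k) ^+ 2 <= B * d a b ^+ 2.
Proof.
pose n := (maxn a b).+1; exists (8 / 3 + 16 * rate R n ^+ 2 * (2 * n)%:R).
apply: (@embed_dist_le _ _ n); rewrite ?ltnS ?leq_maxl ?leq_maxr//.
  move=> z l _ ln; rewrite /rate ler_ln ?posrE ?ltr0n// ler_nat !ltnS.
  exact: leq_trans (crowd_le z l) (ltnW ln).
by move=> m M; rewrite ler_nat card_active_le.
Qed.

Lemma embed_Lfun a : embed a \in @Lfun _ nat R (@counting nat R) 2%:E.
Proof.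
have [B HB] := embed_dist_finite a 0; apply: (Lfun2_bounded (B := B * d a 0 ^+ 2)).
move=> N; apply: le_trans (HB N); apply: ler_sum => k _.
by rewrite embed0 subr0.
Qed.

End Embedding.

(** * The algorithm *)

Section Algorithm.
Variable R : realType.

(* Indices outside the matrix are never used. *)
Definition matrix_fun i (M : 'M[R]_i) (p q : nat) : R :=
  if insub p is Some p' then if insub q is Some q' then M p' q' else 0 else 0.

(** The algorithm must answer on every matrix, even one that is no metric; 0 is the default when the
    sequence is not square-summable. *)
Definition net_algorithm : online_algorithm (ell2 R) := fun i M a =>
  insubd (0 : ell2 R) (embed (matrix_fun M) a).

Variables (X : metricType R) (n : nat) (x : 'I_n -> X) (y : nat -> X).
Hypothesis yx : forall p : 'I_n, y p = x p.

Let d p q := mdist (y p) (y q).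

Let dxx a : d a a = 0. Proof. exact: mdistxx. Qed.
Let dC a b : d a b = d b a. Proof. exact: metric_sym. Qed.
Let dT b a c : d a c <= d a b + d b c. Proof. exact: metric_triangle. Qed.

Lemma runE i (lein : (i <= n)%N) (a : 'I_i) k :
  run net_algorithm x lein a k = embed d a k.
Proof.
rewrite /run /net_algorithm.
have -> : embed (matrix_fun (dist_mx (prefix_seq x lein))) a = embed d a.
  apply/funext => j; rewrite /embed /unpair; case: pickle_inv => //= p.
  have E q b : (q <= a)%N -> (b <= a)%N ->
      matrix_fun (dist_mx (prefix_seq x lein)) q b = d q b.
    move=> qa ba; have qi := leq_ltn_trans qa (ltn_ord a).
    have bi := leq_ltn_trans ba (ltn_ord a).
    rewrite /matrix_fun !insubT mxE /prefix_seq /d /=.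
    by rewrite -(yx (widen_ord lein (Ordinal qi))) -(yx (widen_ord lein (Ordinal bi))).
  rewrite (netcoord_local p.1 (d := matrix_fun _) (d' := d) E).
  (* The subtracted base point has index 0 <= a, hence is local as well. *)
  rewrite (@netcoord_local _ (matrix_fun _) d p.1 0)//.
  by move=> q b; rewrite !leqn0 => /eqP-> /eqP->; exact: E.
by rewrite /insubd insubT//; exact: embed_Lfun.
Qed.

Lemma run_dist_le i (lein : (i <= n)%N) (a b : 'I_i) (B : R) : 0 <= B ->
  (forall N, \sum_(k < N) (embed d a k - embed d b k) ^+ 2 <= B ^+ 2) ->
  mdist (run net_algorithm x lein a) (run net_algorithm x lein b) <= B.
Proof.
move=> B0 HB; apply/(ell2_distP _ _ B0) => N.
by under eq_bigr do rewrite !runE; exact: HB.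
Qed.

Lemma run_dist_ge i (lein : (i <= n)%N) (a b : 'I_i) :
  d a b <= 6 * mdist (run net_algorithm x lein a) (run net_algorithm x lein b).
Proof.
have m0 := mdist_ge0 (run net_algorithm x lein a) (run net_algorithm x lein b).
have [d0|d0] := leP (d a b) 0; first by apply: le_trans d0 _; rewrite mulr_ge0.
have [N HN] := embed_dist_ge dxx dC dT d0.
have /(ell2_distP _ _ m0)/(_ N) := lexx (ell2_dist (run net_algorithm x lein a)
  (run net_algorithm x lein b)).
under eq_bigr do rewrite !runE.
move=> h; rewrite -ler_sqr ?nnegrE ?mulr_ge0 ?(ltW d0)// exprMn.
by apply: le_trans HN _; rewrite (_ : 6 ^+ 2 = 36) ?ler_pM2l//; ring.
Qed.

Lemma run_online_embedding : online_embedding x (run net_algorithm x).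
Proof.
have yE i (lein : (i <= n)%N) (a : 'I_i) : prefix_seq x lein a = y a.
  by rewrite /prefix_seq /= -yx.
split=> [i lein a b|i lein ltin a]; last by apply/LfuneqP => k; rewrite !runE.
rewrite !yE; split=> [fab|yab].
  have := run_dist_ge lein a b; rewrite fab mdistxx mulr0 => d0.
  by apply: mdist_positivity; apply/eqP; rewrite eq_le d0 mdist_ge0.
apply: mdist_positivity; apply/eqP; rewrite eq_le mdist_ge0 andbT.
apply: run_dist_le => // N.
have [B /(_ N)] := embed_dist_finite dxx dC dT a b.
by rewrite /d yab mdistxx expr0n/= mulr0.
Qed.

Lemma run_distortion_le (D T : R) : has_ddim (range x) D -> 1 <= D -> 1 <= T ->
  (forall a b : 'I_n, x a != x b -> forall m M : nat,
     #|[pred i : 'I_m | active d a b n (i%:Z - M%:Z)]|%:R <= 2 * T) ->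
  (forall p, range x (y p)) ->
  distortion x (run net_algorithm x (leqnn n)) <= 204 * D * Num.sqrt T.
Proof.
move=> hD D1 T1 HT Sy; have T0 : 0 <= T by lra.
have D0 : 0 <= D by lra.
have s0 : 0 <= Num.sqrt T := sqrtr_ge0 T.
have B0 : 0 <= 34 * D * Num.sqrt T by rewrite !mulr_ge0.
have dE a b : mdist (x a) (x b) = d a b by rewrite /d !yx.
have -> : 204 * D * Num.sqrt T = (34 * D * Num.sqrt T) * 6 by ring.
apply: ler_pM.
- exact: bigmax_ge_id.
- exact: bigmax_ge_id.
- apply: bigmax_le => [//|[a b] /= xab].
  have dab : 0 < d a b by rewrite -dE mdist_gt0.
  rewrite dE ler_pdivrMr//; apply: run_dist_le => [|N].
    by rewrite mulr_ge0// ltW.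
  apply: le_trans (embed_dist_le dxx dC dT (ltn_ord a) (ltn_ord b)
    (K := 6 * D) _ (HT a b xab) N) _.
    by move=> z l nl _; exact: rate_crowd_le hD D1 Sy nl.
  (* With K = 6 D and 2 T active scales, 8 / 3 + 16 * 36 * 2 D^2 T <= 34^2 D^2 T because D and T are
     at least 1. *)
  rewrite [leRHS]exprMn; apply: ler_wpM2r; first exact: sqr_ge0.
  rewrite [leRHS]exprMn sqr_sqrtr//.
  have D2 : 1 <= D ^+ 2 by rewrite expr_ge1//; lra.
  by rewrite !exprMn; move: (D ^+ 2) D2 => e; nra.
- apply: bigmax_le => // -[a b] /= xab.
  have dab : 0 < d a b by rewrite -dE mdist_gt0.
  have := run_dist_ge (leqnn n) a b; rewrite dE => h.
  by rewrite ler_pdivrMr//; lra.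
Qed.

End Algorithm.

Theorem theorem1p2 (R : realType) :
  exists (A : online_algorithm (ell2 R)) (C : R),
    0 < C /\
    forall (X : metricType R) (n : nat) (x : 'I_n -> X),
      online_embedding x (run A x) /\
      forall D : R, has_ddim (range x) D ->
        distortion x (run A x (leqnn n)) <=
          C * D * Num.min (Num.sqrt (log_bound (aspect_ratio x)))
                          (Num.sqrt n%:R).
Proof.
exists (@net_algorithm R), 204; split=> [|X [|m] x]; first by rewrite ltr0n.
  split=> [|D _].
    split=> [[|i] lein|i lein]; first by case.
      by have := lein; rewrite ltn0.
    by move=> ltin; have := ltin; rewrite ltn0.
  rewrite /distortion /expansion /contraction !big_pred0; try by case=> -[].
  by rewrite mul0r sqrtr0 min_r ?sqrtr_ge0// mulr0.
(* Beyond the last index the first point is repeated, so [y] stays in the range of [x]. *)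
pose y p := x (insubd ord0 p).
have yx (p : 'I_m.+1) : y p = x p by rewrite /y valKd.
have Sy p : range x (y p) by exists (insubd ord0 p).
split=> [|D hD]; first exact: run_online_embedding yx.
set L := log_bound _; set n := m.+1.
(* When all points coincide the distortion is 0, and D >= 0 is enough. *)
have [[a b] /= xab|xx] := pickP (fun p : 'I_m.+1 * 'I_m.+1 => x p.1 != x p.2); last first.
  rewrite /distortion /expansion /contraction !big_pred0// mul0r.
  by rewrite mulr_ge0 ?mulr_ge0 ?(ddim_ge0 hD (Sy 0))// le_min !sqrtr_ge0.
have D1 := ddim_ge1 hD xab.
have dist_le T : 1 <= T -> _ := fun T1 HT => run_distortion_le yx hD D1 T1 HT Sy.
have nle : distortion x (run (@net_algorithm R) x (leqnn n)) <= 204 * D * Num.sqrt n%:R.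
  apply: dist_le => [|p q _ k M]; first by rewrite ler1n.
  rewrite -natrM ler_nat; apply: card_active_le => *; first exact: metric_sym.
  exact: metric_triangle.
have Lle : distortion x (run (@net_algorithm R) x (leqnn n)) <= 204 * D * Num.sqrt L.
  apply: dist_le => [|p q xpq k M]; first by rewrite le_max lexx.
  have diam_ge u v : mdist (x u) (x v) <= diam x.
    exact: (le_bigmax _ (fun p : 'I_n * 'I_n => mdist (x p.1) (x p.2)) (u, v)).
  have min0 : 0 < min_dist x.
    apply: lt_bigmin => [|r xr]; last by rewrite mdist_gt0.
    by apply: lt_le_trans (diam_ge a b); rewrite mdist_gt0.
  (* An active scale is at least the distance of the pair, hence at least [min_dist x], and below
     the distance from an end of the pair to some l, hence below [diam x]. *)
  apply: le_trans (card_scales_log k M (diam x) min0).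
  rewrite ler_nat; apply: subset_leq_card; apply/fintype.subsetP => i.
  rewrite !inE => /activeP[||pq [c [l /andP[zl _]]]].
  - by move=> *; exact: metric_sym.
  - by move=> *; exact: metric_triangle.
  apply/andP; split; last by apply: lt_le_trans zl _; exact: diam_ge.
  apply: le_trans pq; rewrite !yx.
  exact: (bigmin_le_cond _ (j := (p, q))).
by rewrite /Num.min; case: ifP.
Qed.
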